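(* Let $d\ge 1$ be an integer and let $\mathcal{G}_1,\dots,\mathcal{G}_{d+1}$ be general dyadic grids on $\mathbb{R}^d$, where $\mathcal{G}_i$ has base $n_i$ (an integer $\ge 2$), $i=1,\dots,d+1$. Suppose $\mathcal{G}_1,\dots,\mathcal{G}_{d+1}$ are adjacent on $\mathbb{R}^d$. Then there exist an integer $\mathfrak{n}\ge 2$ and integers $s_1,\dots,s_{d+1}\ge 1$ such that $$n_i=\mathfrak{n}^{s_i},\qquad i=1,\dots,d+1.$$
   Context: All cubes have sides parallel to the coordinate axes; $\ell(Q)$ is the sidelength of $Q$. General dyadic grid with base $n$ ($n\ge 2$ an integer): a collection $\mathcal{G}$ of left-closed, right-open cubes $[a_1,a_1+\ell)\times\dots\times[a_d,a_d+\ell)$ in $\mathbb{R}^d$ such that (i) every $Q\in\mathcal{G}$ has sidelength $n^k$ for some $k\in\mathbb{Z}$; (ii) $Q\cap R\in\{Q,R,\emptyset\}$ for all $Q,R\in\mathcal{G}$; (iii) for each $k\in\mathbb{Z}$, the cubes of $\mathcal{G}$ of sidelength $n^k$ form a partition of $\mathbb{R}^d$. Adjacency: general dyadic grids $\mathcal{G}_1,\dots,\mathcal{G}_{d+1}$ on $\mathbb{R}^d$ with bases $n_1,\dots,n_{d+1}$ are adjacent if there is a constant $C>0$, independent of the cubes $Q$ and $D$ below, such that for every open cube $Q\subseteq\mathbb{R}^d$ there exist $i\in\{1,\dots,d+1\}$ and $D\in\mathcal{G}_i$ with $Q\subseteq D$ and $\ell(D)\le C\,\ell(Q)$. *)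

(* Defs.v *)
From mathcomp Require Import all_boot all_order all_algebra.
From mathcomp Require Import boolp classical_sets reals.
Set Implicit Arguments.
Unset Strict Implicit.
Unset Printing Implicit Defensive.
Import Order.TTheory GRing.Theory Num.Theory.
Local Open Scope classical_set_scope.
Local Open Scope ring_scope.

Definition co_cube (R : realType) (d : nat) (a : 'rV[R]_d) (l : R) :
    set 'rV[R]_d :=
  [set x : 'rV[R]_d | forall j : 'I_d, a ord0 j <= x ord0 j < a ord0 j + l].

Definition oo_cube (R : realType) (d : nat) (a : 'rV[R]_d) (l : R) :
    set 'rV[R]_d :=
  [set x : 'rV[R]_d | forall j : 'I_d, a ord0 j < x ord0 j < a ord0 j + l].

(* Cubes are plain subsets of R^d, so the sidelength is a relation; for
   0 < d it is functional, since a nonempty co_cube determines its side. *)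
Definition co_cube_of_side (R : realType) (d : nat) (l : R)
    (Q : set 'rV[R]_d) : Prop :=
  0 < l /\ exists a : 'rV[R]_d, Q = co_cube a l.

Definition general_dyadic_grid (R : realType) (d n : nat)
    (G : set (set 'rV[R]_d)) : Prop :=
  [/\ (2 <= n)%N,
      (forall Q, G Q -> exists k : int, co_cube_of_side (n%:R ^ k) Q),
      (forall P Q, G P -> G Q ->
         [\/ P `&` Q = P, P `&` Q = Q | P `&` Q = set0]) &
      (forall k : int,
         partition (G `&` co_cube_of_side (n%:R ^ k)) id [set: 'rV[R]_d])].

Definition adjacent (R : realType) (d : nat)
    (G : 'I_d.+1 -> set (set 'rV[R]_d)) : Prop :=
  exists2 C : R, 0 < C &
    forall (a : 'rV[R]_d) (l : R), 0 < l ->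
      exists (i : 'I_d.+1) (D : set 'rV[R]_d) (lD : R),
        [/\ G i D, co_cube_of_side lD D, oo_cube a l `<=` D & lD <= C * l].

(* Main.v *)
Require Import Defs.
From mathcomp Require Import all_boot all_order all_algebra.
From mathcomp Require Import boolp classical_sets reals.
From mathcomp Require Import ring lra zify.

(** Every grid is an honest lattice inside each of its own cubes, since a cube
    whose side is a whole number of units has only one tiling by unit cubes.
    All the grids have such large cubes containing one common box as large as
    desired ([common_box]), and inside that box the faces of the cubes of
    side [n_i ^ k] orthogonal to an axis form an arithmetic progression of
    step [n_i ^ k].  A small cube crossing one of these faces can only be
    covered by a cube of grid [i] of larger side
    ([crossing_cube_not_covered]).

    There are [d + 1] grids and [d] axes.  Fix two grids [p] and [q], let them
    share an axis and give each other grid an axis of its own.  A scale [N]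
    determines the coarsest side [s_i <= N] of each grid, a power of [n_i].
    By Bezout, on the shared axis a face of grid [p] and a face of grid [q]
    lie at distance less than [gcd(s_p, s_q)].  Let [M] be an
    integer above the adjacency constant.  If that gcd were less than
    [N / M], some cube of side [N / M] would cross a face of every grid,
    hence be covered only by cubes of side more than [N], against adjacency.
    So [N <= M * gcd(s_p, s_q)] for every [N] ([adjacent_gcd_bound]).

    Consequently [s_p / g] and [s_q / g], where [g] is the gcd, take
    finitely many values as [N] runs through the powers of [n_p].  Two scales
    with the same quotients give [n_p ^ x = n_q ^ y] with [x] and [y] positive
    ([mult_dependent_of_large_gcds]).  Finally, pairwise multiplicatively
    dependent integers are powers of the least integer greater than 1 which is
    dependent with them ([mult_dependent_common_base]). *)

Set Implicit Arguments.
Unset Strict Implicit.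
Unset Printing Implicit Defensive.
Import Order.TTheory GRing.Theory Num.Theory.
Local Open Scope classical_set_scope.
Local Open Scope ring_scope.

(** * Grid cubes inside a larger grid cube *)

Definition with_coord (R : realType) (d : nat) (x : 'rV[R]_d) (j : 'I_d) (t : R)
  : 'rV[R]_d := \row_i (if i == j then t else x ord0 i).

Lemma with_coordE (R : realType) (d : nat) (x : 'rV[R]_d) (j : 'I_d) (t : R) :
  with_coord x j t ord0 j = t.
Proof. by rewrite mxE eqxx. Qed.

Lemma with_coord_co_cube (R : realType) (d : nat) (a x : 'rV[R]_d) (l : R)
    (j : 'I_d) (t : R) :
  co_cube a l x -> a ord0 j <= t < a ord0 j + l ->
  co_cube a l (with_coord x j t).
Proof. by move=> ax at_ i; rewrite mxE; case: eqP => [->|_]. Qed.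

Lemma with_coord_oo_cube (R : realType) (d : nat) (a x : 'rV[R]_d) (l : R)
    (j : 'I_d) (t : R) :
  oo_cube a l x -> a ord0 j < t < a ord0 j + l ->
  oo_cube a l (with_coord x j t).
Proof. by move=> ax at_ i; rewrite mxE; case: eqP => [->|_]. Qed.

Lemma co_cube_corner (R : realType) (d : nat) (a : 'rV[R]_d) (l : R) :
  0 < l -> co_cube a l a.
Proof. by move=> l0 i; rewrite lexx ltrDl. Qed.

Lemma co_cube_sub (R : realType) (d : nat) (a b : 'rV[R]_d) (l l' : R) :
  0 < l -> co_cube a l `<=` co_cube b l' ->
  forall j, b ord0 j <= a ord0 j /\ a ord0 j + l <= b ord0 j + l'.
Proof.
move=> l0 sub j; have /sub/(_ j)/andP[ba ab] := co_cube_corner a l0.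
split=> //; rewrite leNgt; apply/negP => lt.
have /sub/(_ j) : co_cube a l (with_coord a j (b ord0 j + l')).
  by apply: with_coord_co_cube; [exact: co_cube_corner|rewrite lt ltW].
by rewrite with_coordE ltxx andbF.
Qed.

Lemma grid_cube_at (R : realType) (d n : nat) (G : set (set 'rV[R]_d))
    (k : int) (x : 'rV[R]_d) :
  general_dyadic_grid n G ->
  exists2 a, G (co_cube a (n%:R ^ k)) & co_cube a (n%:R ^ k) x.
Proof.
case=> _ _ _ /(_ k)[cov _ _].
have [P [GP [_ [a Pa]]] Px] : cover (G `&` co_cube_of_side (n%:R ^ k)) id x.
  by rewrite cov.
by exists a; rewrite -Pa.
Qed.

Lemma grid_cube_uniq (R : realType) (d n : nat) (G : set (set 'rV[R]_d))
    (k : int) (a b x : 'rV[R]_d) :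
  general_dyadic_grid n G ->
  G (co_cube a (n%:R ^ k)) -> G (co_cube b (n%:R ^ k)) ->
  co_cube a (n%:R ^ k) x -> co_cube b (n%:R ^ k) x ->
  co_cube a (n%:R ^ k) = co_cube b (n%:R ^ k).
Proof.
case=> n2 _ _ /(_ k)[_ triv _] Ga Gb ax bx.
have s0 : (0 : R) < n%:R ^ k by rewrite exprz_gt0 // ltr0n; lia.
by apply: triv; [split=> //; split=> //; eexists..|exists x].
Qed.

Lemma grid_nested (R : realType) (d n : nat) (G : set (set 'rV[R]_d))
    (P Q : set 'rV[R]_d) (x : 'rV[R]_d) :
  general_dyadic_grid n G -> G P -> G Q -> P x -> Q x ->
  P `<=` Q \/ Q `<=` P.
Proof.
case=> _ _ nest _ GP GQ Px Qx; case: (nest P Q GP GQ) => PQ.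
- by left => y; rewrite -PQ => -[].
- by right => y; rewrite -{1}PQ => -[].
- by have : (P `&` Q) x by []; rewrite PQ.
Qed.

(** Inside a cube of the grid the smaller cubes sit on a lattice: a line
    parallel to an axis is cut by them into intervals of length [n ^ k], and
    the first of these must start on the boundary of the big cube because
    grid cubes are nested; each next one starts where the previous one
    ends. *)
Lemma grid_subcube_aligned (R : realType) (d n : nat) (G : set (set 'rV[R]_d))
    (k : int) (A : 'rV[R]_d) (S : R) (j : 'I_d) :
  general_dyadic_grid n G -> G (co_cube A S) -> n%:R ^ k <= S ->
  forall (m : nat) (x a : 'rV[R]_d),
    co_cube A S x -> x ord0 j = A ord0 j + m%:R * n%:R ^ k ->
    G (co_cube a (n%:R ^ k)) -> co_cube a (n%:R ^ k) x ->
    a ord0 j = x ord0 j.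
Proof.
move=> hG GA; set s : R := n%:R ^ k => sS.
have s0 : 0 < s by case: hG => n2 _ _ _; rewrite exprz_gt0 // ltr0n; lia.
elim=> [|m IH] x a Ax xj Ga ax; apply/eqP; rewrite eq_le;
    case/andP: (ax j) => -> /= xlt.
  rewrite xj mul0r addr0.
  have [sub|sub] := grid_nested hG GA Ga Ax ax.
    have S0 := lt_le_trans s0 sS.
    by have [] := co_cube_sub S0 sub j; lra.
  by have [] := co_cube_sub s0 sub j.
rewrite leNgt; apply/negP => lt.
move: xj; rewrite -natr1 mulrDl mul1r => xj.
have ms0 : 0 <= m%:R * s by rewrite mulr_ge0 // ltW.
set c : R := A ord0 j + m%:R * s.
have Ax' : co_cube A S (with_coord x j c).
  by apply: with_coord_co_cube => //; have := Ax j; rewrite xj /c; lra.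
have [a' Ga' ax'] := grid_cube_at k (with_coord x j c) hG.
have := IH _ _ Ax' (with_coordE _ _ _) Ga' ax'.
rewrite with_coordE => a'j.
(* If the cube of [x] started before [x], it would overlap the previous one. *)
pose y := with_coord x j (Num.max (a ord0 j) c).
have ay : co_cube a s y.
  apply: with_coord_co_cube => //.
  by rewrite le_max lexx /= gt_max -/s ltrDl s0 /c; lra.
have a'y : co_cube a' s y.
  move=> i; move: (ax' i); rewrite !mxE; case: eqP => [-> _|//].
  by rewrite a'j le_max lexx orbT gt_max -/s ltrDl s0 /c; lra.
have E := grid_cube_uniq hG Ga Ga' ay a'y.
by move: ax; rewrite E => /(_ j); rewrite a'j /c -/s; lra.
Qed.

(** The hyperplane at [A j + m * n ^ k] separates the cubes of side [n ^ k] of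
    the big cube, so a grid cube covering a set that crosses it contains
    one of them together with points beyond its upper face. *)
Lemma crossing_cube_not_covered (R : realType) (d n : nat)
    (G : set (set 'rV[R]_d)) (k : int) (A q b : 'rV[R]_d) (S r l : R)
    (j : 'I_d) (m : int) :
  general_dyadic_grid n G -> G (co_cube A S) -> n%:R ^ k <= S ->
  oo_cube q r `<=` co_cube A S ->
  q ord0 j < A ord0 j + m%:~R * n%:R ^ k < q ord0 j + r ->
  G (co_cube b l) -> oo_cube q r `<=` co_cube b l ->
  n%:R ^ k < l.
Proof.
move=> hG GA; set s : R := n%:R ^ k => sS QA;
  set c : R := A ord0 j + _ => /andP[qc cq] GD QD.
have s0 : 0 < s by case: hG => n2 _ _ _; rewrite exprz_gt0 // ltr0n; lia.
have Qmid : oo_cube q r (q + const_mx (r / 2)).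
  by move=> i; rewrite !mxE; lra.
pose x := with_coord (q + const_mx (r / 2)) j c.
have Qx : oo_cube q r x by apply: with_coord_oo_cube => //; rewrite qc.
(* [y] lies below the hyperplane, less than one cell away from it. *)
pose t : R := Num.max ((q ord0 j + c) / 2) (c - s / 2).
have tc : t < c by rewrite gt_max; lra.
have qt : q ord0 j < t by rewrite lt_max; apply/orP; left; lra.
have st : c - s <= t by rewrite le_max; apply/orP; right; lra.
pose y := with_coord (q + const_mx (r / 2)) j t.
have Qy : oo_cube q r y.
  by apply: with_coord_oo_cube => //; rewrite qt (lt_trans tc).
have Ac : A ord0 j < c.
  by have := QA _ Qy j; rewrite with_coordE; lra.
have cS : c < A ord0 j + S by have := QA _ Qx j; rewrite with_coordE; lra.
have [m' cE] : exists m' : nat, c = A ord0 j + m'%:R * s + s.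
  have : 0 < m by move: Ac; rewrite /c ltrDl pmulr_lgt0 // ltr0z.
  rewrite /c; case: (m) => // -[//|m'] _; exists m'.
  by rewrite -pmulrn -natr1; ring.
have ms0 : 0 <= m'%:R * s by rewrite mulr_ge0 // ltW.
clearbody c t.
(* The cell just below the hyperplane contains [x'] and [y] but not [x]. *)
pose x' := with_coord x j (c - s).
have Ax' : co_cube A S x'.
  by apply: with_coord_co_cube; [exact: QA|lra].
have [a Ga ax'] := grid_cube_at k x' hG.
have aj : a ord0 j = c - s.
  rewrite (grid_subcube_aligned (j := j) hG GA sS Ax' (m := m') _ Ga ax').
    by rewrite with_coordE.
  by rewrite with_coordE -/s; lra.
have ay : co_cube a s y.
  move=> i; move: (ax' i); rewrite !mxE; case: eqP => [-> _|//].
  by rewrite aj -/s; lra.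
have [sub|sub] := grid_nested hG GD Ga (QD _ Qy) ay.
  by have := sub _ (QD _ Qx) j; rewrite with_coordE aj -/s; lra.
have := QD _ Qx j; have := sub _ ax' j; rewrite !with_coordE; lra.
Qed.

(** * Faces of all the grids crossed by one small cube *)

(** Two grids need not be aligned anywhere near each other, so the cubes are
    found by nesting: the grid cube of side [S] through the centre of a
    box of side [2 * S] stays inside that box. *)
Lemma common_box (R : realType) (d : nat) (I : eqType) (n : I -> nat)
    (G : I -> set (set 'rV[R]_d)) (r : seq I) :
  (forall i, general_dyadic_grid (n i) (G i)) ->
  forall L : R, 0 < L -> exists z : 'rV[R]_d, forall i, i \in r ->
    exists (A : 'rV[R]_d) (S : R),
      [/\ G i (co_cube A S), L <= S & co_cube z L `<=` co_cube A S].
Proof.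
move=> hG; elim: r => [|i r IH] L L0; first by exists 0.
have n2 : (1 < n i)%N by case: (hG i).
have [K LS] : exists K : nat, L <= (n i)%:R ^ (K : int).
  exists (Num.bound L); rewrite -exprnP -natrX.
  apply: le_trans (ltW (archi_boundP (ltW L0))) _.
  by rewrite ler_nat ltnW // ltn_expl.
set S : R := _ ^ _ in LS; have S0 := lt_le_trans L0 LS.
have [|z' box] := IH (2 * S); first by lra.
(* The corner of the new grid cube serves as corner of the smaller box. *)
have [z Gz zx] := grid_cube_at K (z' + const_mx S) (hG i).
have zz' : co_cube z S `<=` co_cube z' (2 * S).
  by move=> y zy t; move: (zx t) (zy t); rewrite !mxE -/S; lra.
have LSz : co_cube z L `<=` co_cube z S by move=> y zy t; move: (zy t); lra.
exists z => i0; rewrite inE => /predU1P[->|/box[A [S' [GA SS' sub]]]].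
  by exists z, S.
by exists A, S'; split=> //; [lra|move=> y /LSz /zz' /sub].
Qed.

Lemma progression_hits (R : realType) (a s lo : R) :
  0 < s -> exists m : int, lo <= a + m%:~R * s < lo + s.
Proof.
move=> s0; exists (- Num.floor ((a - lo) / s)).
have /andP[] := floor_itv ((a - lo) / s); set f := Num.floor _.
rewrite intrD ler_pdivlMr // ltr_pdivrMr // mulrDl mul1r mulrNz; lra.
Qed.

(** The differences [u - v] form a coset of [gcdn s t] times the integers, and a
    given difference recurs with period [s * t], whence the window for [u]. *)
Lemma progressions_meet_up_to_gcd (R : realType) (s t : nat) (a b lo : R) :
  (0 < s)%N -> (0 < t)%N -> exists m m' : int,
    let u := a + m%:~R * s%:R in let v := b + m'%:~R * t%:R in
    lo <= u < lo + s%:R * t%:R /\ 0 <= u - v < (gcdn s t)%:R.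
Proof.
move=> s0 t0; have g0 : (0 : R) < (gcdn s t)%:R by rewrite ltr0n gcdn_gt0 s0.
have [x [y xy]] := Bezoutz s t.
have {}xy : x%:~R * s%:R + y%:~R * t%:R = (gcdn s t)%:R :> R.
  have /(congr1 (fun z : int => z%:~R : R)) := xy.
  by rewrite /gcdz /= intrD !intrM -!pmulrn.
have [e he] := progression_hits (a - b) 0 g0.
have [f hf] : exists f : int,
    lo <= a + (e * x)%:~R * s%:R + f%:~R * (s%:R * t%:R) < lo + s%:R * t%:R.
  by apply: progression_hits; rewrite mulr_gt0 // ltr0n.
exists (e * x + f * t), (f * s - e * y) => u v.
have uE : u = a + (e * x)%:~R * s%:R + f%:~R * (s%:R * t%:R).
  by rewrite /u intrD [(f * t)%:~R]intrM -[t%:~R]pmulrn; ring.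
have uv : u - v = a - b + e%:~R * (gcdn s t)%:R.
  by rewrite /u /v -xy !intrD mulrNz !intrM -!pmulrn; ring.
by rewrite uv uE; split=> //; move: he; lra.
Qed.

(** The number [n i ^ trunc_log (n i) N] is the largest side at most [N] of a
    cube of grid [i] (for [N] positive).  The bound expresses that no small
    cube can cross faces of all the grids at scale [N]; as it only has [d]
    coordinates for [d + 1] grids, a coincidence of faces of [p] and [q] is
    the only obstruction to building one. *)
Lemma adjacent_gcd_bound (R : realType) (d : nat)
    (n : 'I_d.+1 -> nat) (G : 'I_d.+1 -> set (set 'rV[R]_d)) :
  (forall i, general_dyadic_grid (n i) (G i)) -> adjacent G ->
  exists M : nat, forall (p q : 'I_d.+1) (N : nat), p != q -> (0 < N)%N ->
    (N <= M * gcdn (n p ^ trunc_log (n p) N) (n q ^ trunc_log (n q) N))%N.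
Proof.
move=> hG [C C0 adj].
have n2 i : (1 < n i)%N by case: (hG i).
exists (Num.bound C) => p q N pq N0; set M := Num.bound C.
have CM : C < M%:R by apply: archi_boundP; exact: ltW.
have M0 : (0 : R) < M%:R by exact: lt_trans CM.
pose s i := (n i ^ trunc_log (n i) N)%N.
rewrite -/(s p) -/(s q) leqNgt; apply/negP => small.
have s0 i : (0 < s i)%N by rewrite expn_gt0 (ltnW (n2 i)).
have sN i : (s i <= N)%N by apply: trunc_logP.
have M1 : (0 < M)%N by rewrite -(ltr0n R).
pose r : R := N%:R / M%:R.
have r0 : 0 < r by rewrite divr_gt0 // ltr0n.
have gr : (gcdn (s p) (s q))%:R < r.
  by rewrite ltr_pdivlMr // mulrC -natrM ltr_nat.
have rN : r <= N%:R.
  by rewrite ler_pdivrMr // ler_peMr ?ler0n // ler1n.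
have CrN : C * r <= N%:R.
  by rewrite mulrCA ler_piMr ?ler0n // ler_pdivrMr // mul1r ltW.
clearbody r.
(* Room for the window of length [s p * s q <= N ^ 2] of the Bezout
   argument, and a margin [r <= N] on both sides. *)
pose L : R := N%:R ^+ 2 + 2 * N%:R.
have N1 : (1 : R) <= N%:R by rewrite ler1n.
have NN : N%:R <= N%:R ^+ 2 :> R by rewrite expr2 ler_peMr ?ler0n.
have L0 : 0 < L by rewrite /L; lra.
have [z box] := common_box (enum 'I_d.+1) hG L0.
have /choice[A box1] i : exists A : 'rV[R]_d, exists S : R,
    [/\ G i (co_cube A S), L <= S & co_cube z L `<=` co_cube A S].
  by apply: box; rewrite mem_enum.
have qp : q != p by rewrite eq_sym.
have [jp pE] : exists jp : 'I_d, p = lift q jp.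
  by have [jp pE _] := unlift_some qp; exists jp.
(* Grid [lift q j] is given axis [j], and [q] shares the axis of [p]. *)
pose axis i : 'I_d := odflt jp (unlift q i).
have window j : exists aj : R, z ord0 j <= aj /\ aj + r <= z ord0 j + L /\
    forall i, axis i = j ->
      exists m : int, aj < A i ord0 j + m%:~R * (s i)%:R < aj + r.
  have [->|jjp] := eqVneq j jp.
    have [m [m' []]] := progressions_meet_up_to_gcd (A p ord0 jp) (A q ord0 jp)
      (z ord0 jp + r) (s0 p) (s0 q).
    set u := A p _ _ + _; set v := A q _ _ + _ => hu huv.
    have sst : (s p)%:R * (s q)%:R <= N%:R ^+ 2 :> R.
      by rewrite expr2 ler_pM ?ler0n // ler_nat.
    (* An interval of length [r] centred between [u] and [v] contains both,
       as they are less than [r] apart. *)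
    exists ((u + v - r) / 2); do 2![split; first by rewrite /L; lra].
    move=> i; rewrite /axis; case: unliftP => [i' -> /= ->|-> _].
      by exists m; rewrite -pE -/u; lra.
    by exists m'; rewrite -/v; lra.
  have sj0 : (0 : R) < (s (lift q j))%:R by rewrite ltr0n.
  have [m hm] := progression_hits (A (lift q j) ord0 j) (z ord0 j + r) sj0.
  have sj : (s (lift q j))%:R <= N%:R :> R by rewrite ler_nat.
  set u := A _ _ _ + _ in hm.
  exists (u - r / 2); do 2![split; first by rewrite /L; lra].
  move=> i; rewrite /axis; case: unliftP => [i' -> /= ->|_ /= E].
    by exists m; rewrite -/u; lra.
  by rewrite E eqxx in jjp.
have [a ha] := choice window.
have [i [D [lD [GD [lD0 [b Db]] QD lDr]]]] := adj (\row_j a j) r r0.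
have [aj [aL /(_ i erefl)[m hm]]] := ha (axis i).
have [S [GA LS sub]] := box1 i.
have [_ /(_ D GD)[kappa [_ [b' Db']]] _ _] := hG i.
have lt : (n i)%:R ^ (trunc_log (n i) N : int) < (n i)%:R ^ kappa :> R.
  apply: (@crossing_cube_not_covered R d (n i) (G i) _ (A i) (\row_j a j) b'
    S r _ (axis i) m) => //.
  - rewrite -exprnP -natrX; apply: le_trans LS; rewrite /L.
    have : (s i)%:R <= N%:R :> R by rewrite ler_nat.
    by rewrite /s; lra.
  - move=> y Qy; apply: sub => t; have [? [? _]] := ha t.
    by have := Qy t; rewrite mxE; lra.
  - by rewrite mxE -exprnP -natrX.
  - by rewrite -Db'.
  - by rewrite -Db'.
(* Being larger than [s i], the side of [D] is at least the next power of
   [n i], which exceeds [N]; but adjacency bounds it by [N]. *)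
move: lt; rewrite ltr_eXz2l ?ltr1n // => lt.
have : (n i)%:R ^ ((trunc_log (n i) N).+1 : int) <= (n i)%:R ^ kappa :> R.
  by rewrite ler_eXz2l ?ltr1n //; lia.
have /(_ (axis i))[] : forall j, b ord0 j <= b' ord0 j /\
    b' ord0 j + (n i)%:R ^ kappa <= b ord0 j + lD.
  apply: co_cube_sub; first by rewrite exprz_gt0 // ltr0n ltnW.
  by rewrite -Db -Db'.
have : (N%:R : R) < (n i)%:R ^ ((trunc_log (n i) N).+1 : int).
  by rewrite -exprnP -natrX ltr_nat trunc_log_ltn.
lra.
Qed.

(** * Multiplicatively dependent integers *)

Definition mult_dependent (a b : nat) : Prop :=
  exists x y : nat, [/\ (0 < x)%N, (0 < y)%N & (a ^ x = b ^ y)%N].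

Lemma mult_dependent_trans (a b c : nat) :
  mult_dependent a b -> mult_dependent b c -> mult_dependent a c.
Proof.
move=> [x [y [x0 y0 xy]]] [z [w [z0 w0 zw]]].
exists (x * z)%N, (w * y)%N; rewrite !muln_gt0 x0 y0 z0 w0; split=> //.
by rewrite expnM xy -expnM mulnC expnM zw -expnM.
Qed.

(** With [u * x = v * y + 1] the root is [c = b ^ u / a ^ v]. *)
Lemma coprime_exponents_common_root (a b x y : nat) :
  (0 < a)%N -> (0 < x)%N -> (0 < y)%N -> coprime x y -> (a ^ x = b ^ y)%N ->
  exists c : nat, a = (c ^ y)%N /\ b = (c ^ x)%N.
Proof.
move=> a0 x0 y0 co E.
have [u v uv _] := egcdnP y x0.
move: uv; rewrite (eqP co) => uv.
have dv : (a ^ v %| b ^ u)%N.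
  rewrite -(dvdn_pexp2r _ _ x0) -!expnM mulnC expnM E -expnM uv.
  by rewrite mulnC addn1 expnS dvdn_mull.
have bE : ((b ^ u %/ a ^ v) ^ x = b)%N.
  apply/eqP; rewrite -(eqn_pmul2r (_ : 0 < (a ^ v) ^ x)%N) ?expn_gt0 ?a0 ?orbT //.
  rewrite -(expnMn (b ^ u %/ a ^ v)) divnK // -!expnM uv addn1 expnS.
  by rewrite [(v * y)%N]mulnC [(v * x)%N]mulnC !expnM E.
exists (b ^ u %/ a ^ v)%N; split=> //.
by apply: (expIn x0); rewrite E -[in LHS]bE -!expnM mulnC.
Qed.

Lemma mult_dependent_common_root (a b : nat) :
  (1 < a)%N -> mult_dependent a b ->
  exists c x y : nat, [/\ (0 < x)%N, (0 < y)%N, a = (c ^ x)%N & b = (c ^ y)%N].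
Proof.
move=> a1 [x [y [x0 y0 E]]]; have g0 : (0 < gcdn x y)%N by rewrite gcdn_gt0 x0.
have [x1 y1] := (divnK (dvdn_gcdl x y), divnK (dvdn_gcdr x y)).
have x'0 : (0 < x %/ gcdn x y)%N by rewrite divn_gt0 // dvdn_leq // dvdn_gcdl.
have y'0 : (0 < y %/ gcdn x y)%N by rewrite divn_gt0 // dvdn_leq // dvdn_gcdr.
have [||c [-> ->]] // := @coprime_exponents_common_root a b _ _ (ltnW a1) x'0 y'0.
- by rewrite /coprime -(eqn_pmul2r g0) muln_gcdl x1 y1 mul1n.
- by apply: (expIn g0); rewrite -!expnM x1 y1.
by exists c, (y %/ gcdn x y)%N, (x %/ gcdn x y)%N.
Qed.

(** The base is the least integer [m > 1] dependent with [n i0].  Each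
    [n i] shares a root [c] with [m], and [c] is again dependent with [n i0],
    so minimality forces [c = m]. *)
Lemma mult_dependent_common_base (I : Type) (n : I -> nat) (i0 : I) :
  (forall i, (1 < n i)%N) -> (forall i, mult_dependent (n i) (n i0)) ->
  exists (m : nat) (s : I -> nat),
    (2 <= m)%N /\ forall i, (1 <= s i)%N /\ n i = (m ^ s i)%N.
Proof.
move=> n1 dep.
have ex : exists m, (1 < m)%N && `[< mult_dependent m (n i0) >].
  by exists (n i0); rewrite n1; apply/asboolP.
case: (ex_minnP ex) => m /andP[m1 /asboolP [x [y [x0 y0 xy]]]] mmin.
suff /choice[s hs] i : exists s : nat, (1 <= s)%N /\ n i = (m ^ s)%N.
  by exists m, s.
have depm : mult_dependent (n i0) m by exists y, x.
have [c [e [f [e0 f0 nE mE]]]] :=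
  mult_dependent_common_root (n1 i) (mult_dependent_trans (dep i) depm).
have c1 : (1 < c)%N.
  by move: m1; rewrite mE; case: (c) => [|[|//]]; rewrite ?exp1n ?exp0n.
suff cm : c = m by exists e; rewrite -cm.
apply/eqP; rewrite eqn_leq; apply/andP; split.
  by rewrite mE -{1}[c]expn1 leq_exp2l.
have depc : mult_dependent c m by exists f, 1; rewrite f0 expn1.
apply: mmin; rewrite c1; apply/asboolP; apply: mult_dependent_trans depc _.
by exists x, y.
Qed.

(** Pigeonhole: along [N = a ^ t] the pair of quotients of the two powers by
    their gcd is bounded by [M], so it repeats, and two equal pairs give equal
    ratios of a power of [a] to a power of [b]. *)
Lemma mult_dependent_of_large_gcds (a b M : nat) :
  (1 < a)%N -> (1 < b)%N ->
  (forall N, (0 < N)%N ->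
     (N <= M * gcdn (a ^ trunc_log a N) (b ^ trunc_log b N))%N) ->
  mult_dependent a b.
Proof.
move=> a1 b1 bound.
pose l t := trunc_log b (a ^ t); pose g t := gcdn (a ^ t) (b ^ l t).
have at0 t : (0 < a ^ t)%N by rewrite expn_gt0 ltnW.
have g0 t : (0 < g t)%N by rewrite gcdn_gt0 at0.
have tl t : trunc_log a (a ^ t) = t.
  by apply: trunc_log_eq => //; rewrite leqnn ltn_exp2l /=.
have gM t : (a ^ t <= M * g t)%N by have := bound _ (at0 t); rewrite tl.
have quot t x : (x <= a ^ t)%N -> (x %/ g t < M.+1)%N.
  move=> xa; rewrite ltnS; apply: leq_trans (_ : (M * g t) %/ g t <= M)%N.
    by apply: leq_div2r; exact: leq_trans (gM t).
  by rewrite mulnK.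
have bl t : (b ^ l t <= a ^ t)%N by apply: trunc_logP.
pose F (t : 'I_((M.+1 * M.+1).+1)) : 'I_M.+1 * 'I_M.+1 :=
  (Ordinal (quot t _ (leqnn _)), Ordinal (quot t _ (bl t))).
have /injectivePn[t1 [t2 t12 [Ea Eb]]] : ~~ injectiveb F.
  apply/negP => /injectiveP /leq_card; rewrite card_prod !card_ord.
  by rewrite ltnn.
have aE t : (a ^ t = a ^ t %/ g t * g t)%N by rewrite divnK // dvdn_gcdl.
have bE t : (b ^ l t = b ^ l t %/ g t * g t)%N by rewrite divnK // dvdn_gcdr.
have cross : (a ^ t1 * b ^ l t2 = a ^ t2 * b ^ l t1)%N.
  rewrite (aE t1) (aE t2) (bE t1) (bE t2) Ea Eb.
  by rewrite mulnACA [RHS]mulnACA [(g t1 * _)%N]mulnC.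
wlog lt : t1 t2 t12 Ea Eb cross / (t1 < t2)%N.
  move=> W; move: (t12); rewrite neq_ltn => /orP[lt|lt]; first exact: (W t1 t2).
  by apply: (W t2 t1) => //; rewrite eq_sym.
have le : (l t1 < l t2)%N.
  rewrite -(ltn_exp2l _ _ b1) -(ltn_pmul2l (at0 t1)) cross ltn_pmul2r ?ltn_exp2l //.
  by rewrite expn_gt0 ltnW.
exists (t2 - t1)%N, (l t2 - l t1)%N; split; rewrite ?subn_gt0 //.
apply/eqP; rewrite -(eqn_pmul2l (at0 t1)) -expnD subnKC 1?ltnW //.
rewrite -(eqn_pmul2r (_ : 0 < b ^ l t1)%N) ?expn_gt0 1?ltnW // -cross.
by rewrite -mulnA -expnD subnK // ltnW.
Qed.

(** * Bases of adjacent grids *)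

Theorem theorem1p14 (R : realType) (d : nat) (hd : (1 <= d)%N)
    (n : 'I_d.+1 -> nat) (G : 'I_d.+1 -> set (set 'rV[R]_d))
    (hG : forall i : 'I_d.+1, general_dyadic_grid (n i) (G i))
    (hadj : adjacent G) :
  exists (m : nat) (s : 'I_d.+1 -> nat),
    (2 <= m)%N /\
    forall i : 'I_d.+1, (1 <= s i)%N /\ n i = (m ^ s i)%N.
Proof.
have n2 i : (1 < n i)%N by case: (hG i).
have [M bound] := adjacent_gcd_bound hG hadj.
apply: (mult_dependent_common_base (i0 := ord0)) => // i.
have [->|i0] := eqVneq i ord0; first by exists 1%N, 1%N.
by apply: (@mult_dependent_of_large_gcds _ _ M) => // N; apply: bound.
Qed.
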